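(* There exists an algorithm which, given a semi-complete digraph $T$ and an integer $k$, in time $O(2^{O(k)}|V(T)|^2)$ either outputs an ordering of $V(T)$ of width at most $k$, or correctly concludes that $\mathbf{ctw}(T)>k$.
   Context: All digraphs are simple. A digraph $T$ is semi-complete if for every two distinct vertices $v,w$ at least one of the arcs $(v,w)$, $(w,v)$ is present. For an ordering $\pi$ of $V=V(T)$, $\pi[\alpha]$ is the set of its first $\alpha$ vertices; $E(X,Y)$ is the set of arcs from $X$ to $Y$. The width of $\pi$ is $\max_{0\le\alpha\le|V|}|E(\pi[\alpha],V\setminus\pi[\alpha])|$ and the cutwidth $\mathbf{ctw}(T)$ is the minimum width of an ordering of $V$. *)

(* Defs.v *)
From HB Require Import structures.
From mathcomp Require Import all_boot all_order all_algebra.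

Set Implicit Arguments.
Unset Strict Implicit.
Unset Printing Implicit Defensive.

(* A simple digraph on [V] is an irreflexive relation [T : rel V]; [T v w]
   means that the arc (v, w) is present.  Opposite arcs are allowed. *)

Definition semicomplete (V : finType) (T : rel V) : Prop :=
  forall v w : V, v != w -> T v w || T w v.

Definition arcs (V : finType) (T : rel V) (X Y : {set V}) : {set V * V} :=
  [set e | [&& T e.1 e.2, e.1 \in X & e.2 \in Y]].

Definition ordering (V : finType) (pi : seq V) : bool := perm_eq pi (enum V).

Definition prefix_set (V : finType) (pi : seq V) (alpha : nat) : {set V} :=
  [set x in take alpha pi].

Definition width (V : finType) (T : rel V) (pi : seq V) : nat :=
  \max_(alpha < #|V|.+1)
     #|arcs T (prefix_set pi alpha) (~: prefix_set pi alpha)|.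

(* [permutations (enum V)] lists exactly the orderings of [V]; the default
   value of the minimum is itself the width of an ordering. *)
Definition cutwidth (V : finType) (T : rel V) : nat :=
  \big[minn/width T (enum V)]_(pi <- permutations (enum V)) width T pi.

(* Algorithms are programs of a structured language for a random access
   machine with [w]-bit words.  A program mentions finitely many registers and
   finitely many memory banks; every bank is an array of words addressed by
   words.  Every operation, memory access, assignment and control-flow test
   costs one time unit, and no operation acts on anything larger than a word. *)

Inductive binop := Add | Sub | Mul | Div | Mod | Eq | Lt.

Inductive expr :=
  | Const of nat
  | Reg of nat
  | Read of nat & expr                (* bank, address *)
  | Bin of binop & expr & expr.

Inductive cmd :=
  | Skip
  | Assign of nat & expr              (* register, value *)
  | Write of nat & expr & expr        (* bank, address, value *)
  | Seq of cmd & cmd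
  | Ite of expr & cmd & cmd
  | While of expr & cmd.

Record state := State { reg : nat -> nat; mem : nat -> nat -> nat }.

Definition set_reg (s : state) (r v : nat) : state :=
  State (fun r' => if r' == r then v else reg s r') (mem s).

Definition set_mem (s : state) (b i v : nat) : state :=
  State (reg s)
    (fun b' i' => if (b' == b) && (i' == i) then v else mem s b' i').

(* [Sub] is truncated subtraction; division by 0 follows the conventions
   x %/ 0 = 0 and x %% 0 = x. *)
Definition binop_sem (o : binop) (x y : nat) : nat :=
  match o with
  | Add => x + y
  | Sub => x - y
  | Mul => x * y
  | Div => x %/ y
  | Mod => x %% y
  | Eq => x == y
  | Lt => x < y
  end.

(* Constants and results of operations are reduced modulo 2 ^ w. *)
Fixpoint eval (w : nat) (s : state) (e : expr) : nat :=
  match e with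
  | Const m => m %% 2 ^ w
  | Reg r => reg s r
  | Read b e1 => mem s b (eval w s e1)
  | Bin o e1 e2 => binop_sem o (eval w s e1) (eval w s e2) %% 2 ^ w
  end.

Fixpoint cost (e : expr) : nat :=
  match e with
  | Const _ | Reg _ => 1
  | Read _ e1 => (cost e1).+1
  | Bin _ e1 e2 => (cost e1 + cost e2).+1
  end.

(* [exec w p s s' t]: on words of length [w], program [p] started in state [s]
   halts in state [s'] after exactly [t] time units. *)
Inductive exec (w : nat) : cmd -> state -> state -> nat -> Prop :=
  | ExecSkip s : exec w Skip s s 1
  | ExecAssign r e s :
      exec w (Assign r e) s (set_reg s r (eval w s e)) (cost e).+1
  | ExecWrite b e1 e2 s :
      exec w (Write b e1 e2) s (set_mem s b (eval w s e1) (eval w s e2))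
        (cost e1 + cost e2).+1
  | ExecSeq p1 p2 s s1 s2 t1 t2 :
      exec w p1 s s1 t1 -> exec w p2 s1 s2 t2 ->
      exec w (Seq p1 p2) s s2 (t1 + t2)
  | ExecIteTrue e p1 p2 s s' t :
      eval w s e != 0 -> exec w p1 s s' t ->
      exec w (Ite e p1 p2) s s' ((cost e).+1 + t)
  | ExecIteFalse e p1 p2 s s' t :
      eval w s e == 0 -> exec w p2 s s' t ->
      exec w (Ite e p1 p2) s s' ((cost e).+1 + t)
  | ExecWhileFalse e p s :
      eval w s e == 0 -> exec w (While e p) s s (cost e).+1
  | ExecWhileTrue e p s s1 s2 t1 t2 :
      eval w s e != 0 -> exec w p s s1 t1 -> exec w (While e p) s1 s2 t2 ->
      exec w (While e p) s s2 ((cost e).+1 + t1 + t2).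

(* Row-major adjacency matrix: cell i * n + j is 1 iff (i, j) is an arc. *)
Definition adjacency (n : nat) (T : rel 'I_n) (m : nat) : nat :=
  [exists i : 'I_n, exists j : 'I_n, (m == i * n + j) && T i j].

(* Register 0 holds n, registers 1 and 2 hold the absolute value of k and the
   bit k < 0, bank 0 holds the adjacency matrix; everything else is 0. *)
Definition input (n : nat) (T : rel 'I_n) (k : int) : state :=
  State (fun r => match r with
                  | 0 => n
                  | 1 => absz k
                  | 2 => (k < 0)%R
                  | _ => 0
                  end)
        (fun b i => if b == 0 then adjacency T i else 0).

(* Register 0 is 1 and the first n cells of bank 1 list [pi]. *)
Definition outputs (n : nat) (s : state) (pi : seq 'I_n) : Prop :=
  reg s 0 = 1 /\ mkseq (mem s 1) n = map val pi.

Definition rejects (s : state) : Prop := reg s 0 = 0.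

(* Main.v *)
Require Import Defs.
From HB Require Import structures.
From mathcomp Require Import all_boot all_order all_algebra.
From mathcomp Require Import zify.

(* If an ordering has width at most k, the vertex at position q has outdegree
   within k of q: at most k arcs leave the first q + 1 vertices, and at most k
   of the first q vertices fail to be out-neighbours.  Hence an initial
   segment of size a, all of whose own prefixes have cut at most k, is
   determined by its trace on the window of vertices with outdegree in
   [a - k, a + k); by semicompleteness this window has at most 6k + 1 vertices
   as soon as one such segment exists, and only 4k + 1 vertices can extend a
   given segment.  So there are at most 2^(6k+1) of these sets of each size,
   and breadth-first search over them, adding one vertex at a time and
   updating the cut in time O(n), costs 2^O(k) n per size. *)

Set Implicit Arguments.
Unset Strict Implicit.
Unset Printing Implicit Defensive.

(** * Cuts of semicomplete digraphs *)

(** Whether a vertex can extend a segment depends only on the set of vertices in the segment, so the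
    search keeps one order per set and drops the others. The window serves only to count these sets;
    the program never computes it. The threat to the time bound is duplicate elimination: comparing
    a new set with up to [2 ^ (6 * k).+1] stored rows of [n] cells costs [2^O(k) n], and doing so
    for all [n] vertices would make the whole search cubic in [n]. The comparison is therefore made
    only after a constant-time test against a table of out-degrees, which at most [4 * k + 1]
    vertices pass for each segment. The rows of all levels stay in memory; there are [2^O(k) n] of
    them, so addresses fit in words of [O(k + log n)] bits. *)

Section Cuts.
Variables (V : finType) (T : rel V).
Hypotheses (irrT : irreflexive T) (semiT : semicomplete T).
Implicit Types (X Y : {set V}) (p q : seq V) (k : nat).

Definition cut X := #|arcs T X (~: X)|.
Definition outdeg v := #|[set u | T v u]|.
Definition out_in v X := #|[set u in X | T v u]|.
Definition in_from v X := #|[set u in X | T u v]|.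
Definition vset p : {set V} := [set x in p].

Lemma out_inU v X : outdeg v = out_in v X + out_in v (~: X).
Proof.
rewrite /outdeg -(cardsID X); congr (_ + _).
  by apply: eq_card => u; rewrite !inE andbC.
by apply: eq_card => u; rewrite !inE.
Qed.

Lemma card_arcs X Y : #|arcs T X Y| = \sum_(v in X) out_in v Y.
Proof.
rewrite -sum1_card (eq_bigl (fun e : V * V => (e.1 \in X) && ((e.2 \in Y) && T e.1 e.2))).
  rewrite -(pair_big_dep (mem X) (fun v u => (u \in Y) && T v u)
                         (fun _ _ => 1)) /=.
  apply: eq_bigr => v _; rewrite sum1_card.
  by apply: eq_card => u; rewrite !inE.
by case=> u v; rewrite inE /= andbC andbA.
Qed.

Lemma out_in_cut v X : v \in X -> out_in v (~: X) <= cut X.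
Proof. by move=> vX; rewrite /cut card_arcs (bigD1 v) //= leq_addr. Qed.

Lemma in_from_cut v X : v \notin X -> in_from v X <= cut X.
Proof.
move=> vX; rewrite /cut /in_from -(card_imset _ (f := fun u => (u, v))); last by move=> a b [].
apply: subset_leq_card; apply/subsetP => _ /imsetP[u + ->].
by rewrite !inE /= => /andP[-> ->].
Qed.

(** Moving [v] across the cut destroys the arcs from [X] into [v] and creates those from [v] to the
    rest; irreflexivity keeps [v] from counting itself. The two sums are what the program
    accumulates in two registers. *)
Lemma cut_add v X : v \notin X ->
  cut (v |: X) + in_from v X = cut X + out_in v (~: X).
Proof.
move=> vX; rewrite /cut !card_arcs (big_setU1 v) //=.
rewrite addnAC [RHS]addnC -addnA; congr (_ + _).
  apply: eq_card => u; rewrite !inE; case: eqP => // ->.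
  by rewrite irrT !andbF.
have -> : in_from v X = \sum_(u in X) T u v.
  rewrite /in_from -sum1_card big_mkcond [RHS]big_mkcond /=; apply: eq_bigr => u _.
  by rewrite inE; case: (u \in X) => //=; case: (T u v).
rewrite -big_split /=; apply: eq_bigr => u uX.
rewrite /out_in -[RHS](cardsID [set v]); congr (_ + _).
  case Tuv: (T u v); last first.
    by symmetry; apply/eqP; rewrite cards_eq0; apply/eqP/setP => x;
       rewrite !inE; case: eqP => [->|]; rewrite ?Tuv ?andbF.
  rewrite /= -(cards1 v); apply: eq_card => x; rewrite !inE.
  by case: eqP => [->|]; rewrite ?andbF // Tuv vX.
by apply: eq_card => x; rewrite !inE negb_or -!andbA.
Qed.

Lemma semicomplete_total v X : v \notin X -> #|X| <= out_in v X + in_from v X.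
Proof.
move=> vX; rewrite /out_in /in_from -cardsUI.
apply: leq_trans (leq_addr _ _); apply: subset_leq_card; apply/subsetP => u uX.
rewrite !inE uX /=; apply: semiT.
by apply: contraNneq vX => ->.
Qed.

(* Each of the pairs inside Y carries an arc, so out-degrees inside Y average
   at least (|Y| - 1) / 2. *)
Lemma card_low_outdeg Y m :
  (forall v, v \in Y -> out_in v Y <= m) -> #|Y| <= (2 * m).+1.
Proof.
move=> low; have [->|[v0 v0Y]] := set_0Vmem Y; first by rewrite cards0.
have Y_gt0 : 0 < #|Y| by apply/card_gt0P; exists v0.
have sum_out : \sum_(v in Y) out_in v Y <= #|Y| * m.
  by rewrite -sum_nat_const leq_sum.
have sum_in : \sum_(v in Y) in_from v Y = \sum_(v in Y) out_in v Y.
  transitivity (\sum_(v in Y) \sum_(u in Y) T u v).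
    apply: eq_bigr => v _; rewrite /in_from -sum1_card big_mkcond [RHS]big_mkcond.
    by apply: eq_bigr => u _; rewrite inE; case: (u \in Y); case: (T u v).
  rewrite exchange_big; apply: eq_bigr => v _.
  rewrite /out_in -sum1_card big_mkcond [RHS]big_mkcond.
  by apply: eq_bigr => u _; rewrite inE; case: (u \in Y); case: (T v u).
have: #|Y| * #|Y|.-1 <= \sum_(v in Y) (out_in v Y + in_from v Y).
  rewrite -sum_nat_const; apply: leq_sum => v vY.
  have -> : #|Y|.-1 = #|Y :\ v| by rewrite (cardsD1 v Y) vY.
  have: v \notin Y :\ v by rewrite !inE eqxx.
  move=> /semicomplete_total /leq_trans; apply; apply: leq_add;
    by apply: subset_leq_card; apply/subsetP => u; rewrite !inE => /andP[/andP[_ ->] ->].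
rewrite big_split /= sum_in => /leq_trans/(_ (leq_add sum_out sum_out)).
rewrite -mulnDr leq_pmul2l // addnn -mul2n; lia.
Qed.

(** * Initial segments with small cuts *)

Definition valid k p :=
  uniq p && [forall a : 'I_(size p).+1, cut (vset (take a p)) <= k].

Lemma valid_uniq k p : valid k p -> uniq p. Proof. by case/andP. Qed.

Lemma valid_take k p a : valid k p -> cut (vset (take a p)) <= k.
Proof.
case/andP=> _ /forallP H; have [sa|sa] := leqP a (size p).
  exact: (H (Ordinal (sa : a < (size p).+1))).
by move: (H ord_max); rewrite /= take_size take_oversize // ltnW.
Qed.

Lemma valid_cut k p : valid k p -> cut (vset p) <= k.
Proof. by move/(@valid_take _ _ (size p)); rewrite take_size. Qed.

Lemma vset_rcons p v : vset (rcons p v) = v |: vset p.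
Proof. by apply/setP => u; rewrite !inE mem_rcons inE. Qed.

Lemma valid_nil k : valid k [::].
Proof.
apply/andP; split=> //; apply/forallP => a.
by rewrite /cut card_arcs big_pred0 // => v; rewrite inE.
Qed.

Lemma valid_rcons k p v :
  valid k (rcons p v) = [&& valid k p, v \notin p & cut (v |: vset p) <= k].
Proof.
apply/idP/idP=> [val|/and3P[val vp cutv]].
  have := valid_uniq val; rewrite rcons_uniq => /andP[-> up].
  rewrite -vset_rcons (valid_cut val) !andbT /valid up; apply/forallP => a.
  have := valid_take a val; rewrite -cats1 takel_cat //.
  by rewrite -ltnS.
apply/andP; split; first by rewrite rcons_uniq vp (valid_uniq val).
apply/forallP => [[a /=]]; rewrite size_rcons ltnS leq_eqVlt => /predU1P[->|lt_a].
  by rewrite take_oversize ?size_rcons // vset_rcons.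
by rewrite -cats1 takel_cat // (valid_take a val).
Qed.

Lemma card_vset p : uniq p -> #|vset p| = size p.
Proof. by move/card_uniqP <-; apply: eq_card => u; rewrite inE. Qed.

(** The arcs from [p] to [v] cross the cut, so [v] dominates all but [k] vertices of [p]. This works
    for every outside vertex, not only the next one, and so low out-degree forces membership. *)
Lemma outdeg_notin k p v : valid k p -> v \notin p -> size p <= outdeg v + k.
Proof.
move=> val vp; rewrite -(card_vset (valid_uniq val)).
have vX : v \notin vset p by rewrite inE.
have := semicomplete_total vX; have := in_from_cut vX; have := valid_cut val.
have := out_inU v (vset p); lia.
Qed.

Lemma outdeg_rcons k p v : valid k (rcons p v) -> outdeg v <= size p + k.
Proof.
move=> val; have := val; rewrite valid_rcons => /and3P[valp vp cutv].
rewrite (out_inU v (v |: vset p)); apply: leq_add; last first.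
  by apply: leq_trans cutv; apply: out_in_cut; rewrite !inE eqxx.
rewrite -(card_vset (valid_uniq valp)); apply: subset_leq_card; apply/subsetP => u.
by rewrite !inE; case: eqP => [->|_]; rewrite ?irrT ?andbF //= => /andP[].
Qed.

(* By outdeg_rcons, only these vertices can extend p. *)
Definition near k p := [set v | (v \notin p) && (outdeg v <= size p + k)].

(** A near vertex has at least [size p - k] out-neighbours in [p] and at most [size p + k] in all,
    hence at most [2 * k] outside [p]; the averaging bound applies to the near vertices among
    themselves. *)
Lemma card_near k p : valid k p -> #|near k p| <= (4 * k).+1.
Proof.
move=> val; rewrite -[4 * k](mulnA 2 2); apply: card_low_outdeg => v.
rewrite inE => /andP[vp dv].
have vX : v \notin vset p by rewrite inE.
have outN : out_in v (near k p) <= out_in v (~: vset p).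
  by apply: subset_leq_card; apply/subsetP => u; rewrite !inE => /andP[/andP[-> _] ->].
have := semicomplete_total vX; have := in_from_cut vX; have := valid_cut val.
rewrite (card_vset (valid_uniq val)).
have := out_inU v (vset p); lia.
Qed.

Lemma outdeg_in k p v : valid k p -> v \in p ->
  index v p <= outdeg v + k /\ outdeg v <= index v p + k.
Proof.
move=> val; elim/last_ind: p val => // p u IH val.
rewrite mem_rcons inE -cats1 index_cat.
have := val; rewrite valid_rcons => /and3P[valp up cutu].
case: (boolP (v \in p)) => [vp _|vp]; first exact: IH.
rewrite orbF => /eqP->; rewrite /= eqxx addn0.
by split; [exact: outdeg_notin | exact: outdeg_rcons val].
Qed.

(** Half-open because the last position of a segment of size [a] is [a - 1]: out-degree below the
    window forces membership, out-degree above it excludes membership. *)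
Definition window k a := [set v | (a <= outdeg v + k) && (outdeg v < a + k)].

Lemma card_window k p : valid k p -> #|window k (size p)| <= (6 * k).+1.
Proof.
move=> val; rewrite -(cardsID (vset p)).
have -> : (6 * k).+1 = 2 * k + (4 * k).+1 by lia.
apply: leq_add; last first.
  apply: leq_trans (card_near val); apply: subset_leq_card; apply/subsetP => v.
  by rewrite !inE => /andP[-> /andP[_ /ltnW ->]].
(* Inside [p] the window meets only the last [2 * k] positions: position [i] has out-degree at most
   [i + k], so [size p <= i + 2 * k]. *)
rewrite cardE -(size_map (index^~ p)) -[leqRHS](size_iota (size p - 2 * k)).
apply: uniq_leq_size.
  rewrite map_inj_in_uniq ?enum_uniq // => u v.
  rewrite !mem_enum !inE => /andP[_ up] /andP[_ vp] eq_uv.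
  by rewrite -(nth_index u up) eq_uv nth_index.
move=> _ /mapP[v + ->]; rewrite mem_enum !inE mem_iota => /andP[/andP[av _] vp].
have [_] := outdeg_in val vp; have := vp; rewrite -index_mem;
  move: av; set s := size p; set d := outdeg v; set i := index v p; lia.
Qed.

Definition distinct k a (L : seq (seq V)) :=
  all (fun p => valid k p && (size p == a)) L && uniq (map vset L).

(** A vertex of [p] off the window must lie below it, as its position is less than [size p]; its low
    out-degree then puts it in every valid segment of this size. *)
Lemma valid_window k p q : valid k p -> valid k q -> size p = size q ->
  vset p :&: window k (size p) = vset q :&: window k (size p) -> {subset p <= q}.
Proof.
move=> valp valq eq_sz /setP eq_pq v vp.
have [vW|] := boolP (v \in window k (size p)).
  by have := eq_pq v; rewrite !in_setI vW !andbT !inE vp => <-.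
rewrite inE negb_and -ltnNge -leqNgt => vW; apply/idPn => vq.
have := outdeg_notin valq vq; have [_] := outdeg_in valp vp.
have := vp; rewrite -index_mem -eq_sz; move: vW.
set s := size p; set d := outdeg v; set i := index v p; lia.
Qed.

Lemma size_distinct k a L : distinct k a L -> size L <= 2 ^ (6 * k).+1.
Proof.
(* The window is known to be small only once some valid segment of this size exists; [p0] is that
   witness. *)
case: L => [//|p0 L0]; set L := _ :: _ => /andP[/allP LP uL].
have p0L : p0 \in L by exact: mem_head.
have /andP[val0 /eqP sz0] := LP _ p0L.
apply: leq_trans (leq_pexp2l _ (card_window val0)) => //.
rewrite -card_powerset cardE sz0 -(size_map vset L).
rewrite -(size_map (fun X => X :&: window k a)).
apply: uniq_leq_size => [|_ /mapP[X _ ->]]; last by rewrite mem_enum inE subsetIr.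
rewrite map_inj_in_uniq // => _ _ /mapP[p pL ->] /mapP[q qL ->] eq_pq.
have [/andP[valp /eqP sp] /andP[valq /eqP sq]] := (LP _ pL, LP _ qL).
by apply/setP => v; rewrite !inE; apply/idP/idP;
  apply: (@valid_window k); rewrite ?sp ?sq.
Qed.

(** * Breadth-first search *)

(** The first two tests take constant time and say that [v] is in [near k p]; the cut has to be
    computed only for these few vertices. *)
Definition candidate k p v := [&& v \notin p, outdeg v <= size p + k & cut (v |: vset p) <= k].
Definition insert L p := if vset p \in map vset L then L else rcons L p.
Definition extend1 k p L v := if candidate k p v then insert L (rcons p v) else L.
Definition extend k L p := foldl (extend1 k p) L (enum V).
Definition next_level k L := foldl (extend k) [::] L.
Definition level k a := iter a (next_level k) [:: [::]].

Lemma insert_distinct k a L p : valid k p -> size p = a ->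
  distinct k a L -> distinct k a (insert L p).
Proof.
rewrite /insert /distinct => valp sp /andP[aL uL].
case: ifPn => pL; first by rewrite aL.
by rewrite all_rcons valp sp eqxx aL map_rcons rcons_uniq pL.
Qed.

Lemma extend1_distinct k a L p v : valid k p -> size p = a ->
  distinct k a.+1 L -> distinct k a.+1 (extend1 k p L v).
Proof.
rewrite /extend1 => valp sp; case: ifP => // /and3P[vp _ cutv].
by apply: insert_distinct; rewrite ?size_rcons ?sp // valid_rcons valp vp.
Qed.

Lemma foldl_distinct k a L p s : valid k p -> size p = a ->
  distinct k a.+1 L -> distinct k a.+1 (foldl (extend1 k p) L s).
Proof.
by move=> valp sp; elim: s L => // v s IH L dL; apply/IH/extend1_distinct.
Qed.

Lemma foldl_extend_distinct k a L s :
  all (fun p => valid k p && (size p == a)) s ->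
  distinct k a.+1 L -> distinct k a.+1 (foldl (extend k) L s).
Proof.
elim: s L => // p s IH L /= /andP[/andP[valp /eqP sp] Ps] dL.
by apply: IH => //; apply: foldl_distinct.
Qed.

Lemma level_distinct k a : distinct k a (level k a).
Proof.
elim: a => [|a IH]; first by rewrite /distinct /= valid_nil.
by apply: foldl_extend_distinct => //; case/andP: IH.
Qed.

(** * Completeness of the search *)

Lemma mem_insert L p X : X \in map vset L -> X \in map vset (insert L p).
Proof.
by rewrite /insert; case: ifP => // _; rewrite map_rcons mem_rcons inE orbC => ->.
Qed.

Lemma insertP L p : vset p \in map vset (insert L p).
Proof.
by rewrite /insert; case: ifP => // _; rewrite map_rcons mem_rcons mem_head.
Qed.

Lemma mem_foldl1 k L p s X :
  X \in map vset L -> X \in map vset (foldl (extend1 k p) L s).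
Proof.
elim: s L => // v s IH L XL; apply: IH; rewrite /extend1.
by case: ifP => // _; apply: mem_insert.
Qed.

Lemma mem_foldl k L s X :
  X \in map vset L -> X \in map vset (foldl (extend k) L s).
Proof. by elim: s L => // p s IH L XL; apply/IH/mem_foldl1. Qed.

Lemma foldl1P k L p v s : candidate k p v -> v \in s ->
  v |: vset p \in map vset (foldl (extend1 k p) L s).
Proof.
move=> cv; elim: s L => //= u s IH L; rewrite inE => /predU1P[<-|/IH->//].
by apply: mem_foldl1; rewrite /extend1 cv -vset_rcons insertP.
Qed.

Lemma foldlP k L p v s : candidate k p v -> p \in s ->
  v |: vset p \in map vset (foldl (extend k) L s).
Proof.
move=> cv; elim: s L => //= q s IH L; rewrite inE => /predU1P[<-|/IH->//].
by apply: mem_foldl; rewrite foldl1P // mem_enum.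
Qed.

(** The stored segment [q] may order the set of [p] differently, but being a candidate depends only
    on the set and its size, so whatever extends [p] extends [q]. *)
Lemma level_complete k p : valid k p -> vset p \in map vset (level k (size p)).
Proof.
elim/last_ind: p => [|p v IH] val; first by rewrite mem_head.
have := val; rewrite valid_rcons => /and3P[valp vp cutv].
have /mapP[q qL eq_pq] := IH valp.
have /andP[/allP/(_ _ qL)/andP[valq /eqP sq] _] := level_distinct k (size p).
rewrite vset_rcons size_rcons eq_pq; apply: foldlP => //.
apply/and3P; split; last by rewrite -eq_pq.
  by move: vp; have /setP/(_ v) := eq_pq; rewrite !inE => ->.
by rewrite sq; apply: outdeg_rcons val.
Qed.

(** * Valid segments of full length and cutwidth *)

Lemma valid_width k p : valid k p -> width T p <= k.
Proof. by move=> val; apply/bigmax_leqP => a _; apply: valid_take. Qed.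

Lemma width_valid k p : ordering p -> width T p <= k -> valid k p.
Proof.
move=> op /bigmax_leqP wp.
have sp : size p = #|V| by rewrite (perm_size op) cardE.
rewrite /valid (perm_uniq op) enum_uniq; apply/forallP => a.
by apply: (wp (cast_ord (congr1 S sp) a)).
Qed.

Lemma valid_ordering k p : valid k p -> size p = #|V| -> ordering p.
Proof.
move=> /valid_uniq up sp; rewrite /ordering uniq_perm ?enum_uniq // => v.
rewrite mem_enum; apply/idP.
have /eqP/setP/(_ v) : vset p == setT.
  by rewrite eqEcard subsetT cardsT card_vset ?sp /=.
by rewrite !inE.
Qed.

Lemma cutwidth_attained : exists2 p, ordering p & cutwidth T = width T p.
Proof.
rewrite /cutwidth big_seq; elim/big_ind: _ => [|x y [p op ->] [q oq ->]|p].
- by exists (enum V) => //; apply: perm_refl.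
- by case: leqP; [exists p|exists q].
by rewrite mem_permutations => op; exists p.
Qed.

Lemma level_nil_cutwidth k : level k #|V| = [::] -> k < cutwidth T.
Proof.
move=> nil; have [p op ->] := cutwidth_attained; rewrite ltnNge.
apply/negP => /(width_valid op)/level_complete.
by rewrite (perm_size op) -cardE nil.
Qed.
End Cuts.

(** * Total correctness with running time *)

(* Defs.mem is hidden by ssrbool.mem. *)
Import Defs.

(* Evaluation over unbounded naturals; it agrees with eval on the expressions
   that fit in w-bit words. *)
Fixpoint ev (s : state) (e : expr) : nat :=
  match e with
  | Const m => m
  | Reg r => reg s r
  | Read b e1 => mem s b (ev s e1)
  | Bin o e1 e2 => binop_sem o (ev s e1) (ev s e2)
  end.

Fixpoint fits (w : nat) (s : state) (e : expr) : Prop :=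
  match e with
  | Const m => m < 2 ^ w
  | Reg r => True
  | Read b e1 => fits w s e1
  | Bin o e1 e2 =>
      [/\ fits w s e1, fits w s e2 & binop_sem o (ev s e1) (ev s e2) < 2 ^ w]
  end.

Lemma eval_ev w s e : fits w s e -> eval w s e = ev s e.
Proof.
elim: e => //= [m|b e IH fe|o e1 IH1 e2 IH2 [/IH1-> /IH2->]].
- by move/modn_small.
- by rewrite IH.
by move/modn_small.
Qed.

Fixpoint written_regs (p : cmd) : seq nat :=
  match p with
  | Assign r _ => [:: r]
  | Seq p1 p2 | Ite _ p1 p2 => written_regs p1 ++ written_regs p2
  | While _ p1 => written_regs p1
  | _ => [::]
  end.

Fixpoint written_banks (p : cmd) : seq nat :=
  match p with
  | Write b _ _ => [:: b]
  | Seq p1 p2 | Ite _ p1 p2 => written_banks p1 ++ written_banks p2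
  | While _ p1 => written_banks p1
  | _ => [::]
  end.

Definition agree_off (rs bs : seq nat) (s s' : state) : Prop :=
  (forall r, r \notin rs -> reg s' r = reg s r) /\
  (forall b i, b \notin bs -> mem s' b i = mem s b i).

(** The write sets are read off the syntax, so for a concrete program membership in them computes
    and unchanged registers and banks are found by [isT]. *)
Definition frame p := agree_off (written_regs p) (written_banks p).

Lemma agree_off_sub rs bs rs' bs' s s' : {subset rs <= rs'} -> {subset bs <= bs'} ->
  agree_off rs bs s s' -> agree_off rs' bs' s s'.
Proof.
move=> sr sb [fr fb]; split=> [r r_|b i b_].
  by apply: fr; apply: contra r_; apply: sr.
by apply: fb; apply: contra b_; apply: sb.
Qed.

Lemma agree_off_trans rs bs s1 s2 s3 :
  agree_off rs bs s1 s2 -> agree_off rs bs s2 s3 -> agree_off rs bs s1 s3.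
Proof.
move=> [r12 b12] [r23 b23].
by split=> [r ?|b i ?]; [rewrite r23 ?r12|rewrite b23 ?b12].
Qed.

Lemma exec_frame w p s s' t : exec w p s s' t -> frame p s s'.
Proof.
rewrite /frame; elim=> {p s s' t} //=.
- by move=> r e s; split=> //= r'; rewrite inE => /negPf->.
- by move=> b e1 e2 s; split=> //= b' i; rewrite inE => /negPf->.
- move=> p1 p2 s s1 s2 t1 t2 _ IH1 _ IH2.
  apply: agree_off_trans (agree_off_sub _ _ IH1) (agree_off_sub _ _ IH2);
    by move=> x; rewrite mem_cat => ->; rewrite ?orbT.
- move=> e p1 p2 s s' t _ _; apply: agree_off_sub;
    by move=> x; rewrite mem_cat => ->.
- move=> e p1 p2 s s' t _ _; apply: agree_off_sub;
    by move=> x; rewrite mem_cat => ->; rewrite orbT.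
by move=> e p s s1 s2 t1 t2 _ _ IH1 _ IH2; apply: agree_off_trans IH1 IH2.
Qed.

(** A total-correctness Hoare triple with time budget [B]. The initial state is fixed, so [Q] may
    refer to it. *)
Definition runs w p s B (Q : state -> Prop) :=
  exists s' t, [/\ exec w p s s' t, t <= B & Q s'].

Lemma runs_weaken w p s B B' (Q Q' : state -> Prop) : runs w p s B Q ->
  B <= B' -> (forall s', frame p s s' -> Q s' -> Q' s') -> runs w p s B' Q'.
Proof.
move=> [s' [t [ex tB Qs']]] BB' QQ'; exists s', t; split=> //.
  exact: leq_trans BB'.
by apply: QQ' => //; apply: exec_frame ex.
Qed.

Lemma runs_skip w s B (Q : state -> Prop) : 0 < B -> Q s -> runs w Skip s B Q.
Proof. by move=> B0 Qs; exists s, 1; split=> //; apply: ExecSkip. Qed.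

Lemma runs_assign w r e s B (Q : state -> Prop) :
  fits w s e -> cost e < B -> Q (set_reg s r (ev s e)) -> runs w (Assign r e) s B Q.
Proof.
move=> fe eB Qs; exists (set_reg s r (ev s e)), (cost e).+1; split=> //.
by rewrite -(eval_ev fe); apply: ExecAssign.
Qed.

Lemma runs_write w b e1 e2 s B (Q : state -> Prop) :
  fits w s e1 -> fits w s e2 -> cost e1 + cost e2 < B ->
  Q (set_mem s b (ev s e1) (ev s e2)) -> runs w (Write b e1 e2) s B Q.
Proof.
move=> f1 f2 eB Qs; exists (set_mem s b (ev s e1) (ev s e2)), (cost e1 + cost e2).+1.
by split=> //; rewrite -(eval_ev f1) -(eval_ev f2); apply: ExecWrite.
Qed.

Lemma runs_seq w p1 p2 s B B1 (Q R : state -> Prop) :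
  runs w p1 s B1 R -> B1 <= B ->
  (forall s', frame p1 s s' -> R s' -> runs w p2 s' (B - B1) Q) ->
  runs w (Seq p1 p2) s B Q.
Proof.
move=> [s1 [t1 [ex1 tB1 Rs1]]] B1B /(_ s1 (exec_frame ex1) Rs1) [s2 [t2 [ex2 tB2 Qs2]]].
exists s2, (t1 + t2); split=> //; first exact: ExecSeq ex1 ex2.
by rewrite -(subnKC B1B) leq_add.
Qed.

Lemma runs_ite w e p1 p2 s B (Q : state -> Prop) :
  fits w s e -> cost e < B ->
  (ev s e != 0 -> runs w p1 s (B - (cost e).+1) Q) ->
  (ev s e = 0 -> runs w p2 s (B - (cost e).+1) Q) ->
  runs w (Ite e p1 p2) s B Q.
Proof.
move=> fe eB H1 H2; have [e0|e0] := eqVneq (ev s e) 0.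
  have [s' [t [ex tB Qs']]] := H2 e0; exists s', ((cost e).+1 + t).
  by split=> //; [apply: ExecIteFalse; rewrite // eval_ev // e0|lia].
have [s' [t [ex tB Qs']]] := H1 e0; exists s', ((cost e).+1 + t).
by split=> //; [apply: ExecIteTrue; rewrite // eval_ev|lia].
Qed.

(** * Counting loops *)

Definition For r m body :=
  While (Bin Lt (Reg r) (Reg m)) (Seq body (Assign r (Bin Add (Reg r) (Const 1)))).

(** Each round pays 4 for the test and 4 for the increment; the final 4 is the failing test. The
    budget [tau] may vary with the round, so that expensive rounds can be counted separately. *)
Lemma runs_for w r m body s B N lo (I : nat -> state -> Prop) (tau : nat -> nat) :
  r \notin written_regs body -> m \notin r :: written_regs body ->
  reg s m = N -> N < 2 ^ w -> 1 < 2 ^ w -> reg s r = lo -> lo <= N ->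
  I lo s ->
  (forall i s', lo <= i < N -> frame (For r m body) s s' -> reg s' r = i -> I i s' ->
     runs w body s' (tau i) (fun s'' => I i.+1 (set_reg s'' r i.+1))) ->
  \sum_(lo <= i < N) (tau i + 8) + 4 <= B ->
  runs w (For r m body) s B (fun s' => reg s' r = N /\ I N s').
Proof.
move=> r_b m_b sm Nw w1 sr loN Is step.
have m_for : m \notin written_regs (For r m body).
  by rewrite /= mem_cat mem_seq1 orbC -in_cons.
suff from d i s1 : N - i = d -> lo <= i <= N -> frame (For r m body) s s1 ->
    reg s1 r = i -> I i s1 ->
    runs w (For r m body) s1 (\sum_(i <= j < N) (tau j + 8) + 4)
      (fun s' => reg s' r = N /\ I N s').
  move=> HB; have /(_ erefl) := from (N - lo) lo s; rewrite loN leqnn => run.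
  have fr0 : frame (For r m body) s s by [].
  exact: runs_weaken (run isT fr0 sr Is) HB _.
elim: d i s1 => [|d IH] i s1 dE /andP[lo_i iN] fr s1r Is1.
  have {dE} eqiN : i = N by lia.
  exists s1, 4; split; rewrite ?leq_addl //; last by rewrite -eqiN.
  apply: (@ExecWhileFalse w (Bin Lt (Reg r) (Reg m))).
  by rewrite /= (fr.1 m m_for) s1r sm eqiN ltnn mod0n.
have lt_iN : i < N by lia.
have [|s2 [t2 [ex2 tB2 Is2]]] := step i s1 _ fr s1r Is1; first by rewrite lo_i.
have fr2 := exec_frame ex2.
set s3 := set_reg s2 r i.+1 in Is2.
have ex3 : exec w (Assign r (Bin Add (Reg r) (Const 1))) s2 s3 4.
  have -> : s3 = set_reg s2 r (eval w s2 (Bin Add (Reg r) (Const 1))).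
    by rewrite /= (fr2.1 r r_b) s1r (modn_small w1) addn1 modn_small //; lia.
  exact: ExecAssign.
have ex23 := ExecSeq ex2 ex3.
have fr3 : frame (For r m body) s s3 by apply: agree_off_trans fr (exec_frame ex23).
have [||//|s4 [t4 [ex4 tB4 Qs4]]] := IH i.+1 s3 _ _ fr3 _ Is2.
- lia.
- by rewrite ltnW.
- by rewrite /= eqxx.
exists s4, (4 + (t2 + 4) + t4); split=> //; last by rewrite big_ltn //; lia.
apply: (@ExecWhileTrue w (Bin Lt (Reg r) (Reg m))) ex23 ex4.
by rewrite /= (fr.1 m m_for) s1r sm lt_iN modn_small.
Qed.

Definition Loop r m body := Seq (Assign r (Const 0)) (For r m body).

Lemma runs_loop n w r m body s B (I : nat -> state -> Prop) (tau : 'I_n -> nat) :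
  r \notin written_regs body -> m \notin r :: written_regs body ->
  reg s m = n -> n < 2 ^ w -> 1 < 2 ^ w ->
  I 0 (set_reg s r 0) ->
  (forall (i : 'I_n) s', frame (Loop r m body) s s' -> reg s' r = i -> I i s' ->
     runs w body s' (tau i) (fun s'' => I i.+1 (set_reg s'' r i.+1))) ->
  \sum_i (tau i + 8) + 6 <= B ->
  runs w (Loop r m body) s B (fun s' => I n s').
Proof.
move=> r_b m_b sm nw w1 I0 step HB; apply: (runs_seq (B1 := 2) (R := eq (set_reg s r 0))).
- by apply: runs_assign => //=; lia.
- lia.
move=> s1 + eq_s1; rewrite -eq_s1 => fr0; set s0 := set_reg s r 0.
have s0m : reg s0 m = n.
  by rewrite /s0 /=; case: eqP m_b => // ->; rewrite mem_head.
(* Extends the budgets from ['I_n] to all naturals, with value 0 at rounds that never happen. *)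
pose tau' i := oapp tau 0 (insub i : option 'I_n).
apply: (runs_weaken (Q := fun s' => reg s' r = n /\ I n s') _ (leqnn _));
  last by move=> s' _ [].
apply: (runs_for r_b m_b s0m nw w1 _ (leq0n n) I0 (tau := tau')).
- by rewrite /s0 /= eqxx.
- move=> i s' /= lt_in fr s'r Is'; rewrite /tau' insubT /=.
  apply: step => //.
  apply: agree_off_trans (agree_off_sub _ _ fr0) (agree_off_sub _ _ fr);
    by move=> x; rewrite /= ?inE ?mem_cat => ->; rewrite ?orbT.
rewrite big_mkord (eq_bigr (fun i => tau i + 8)); last by move=> i _; rewrite /tau' valK.
by move: HB; set X := \sum_i _; lia.
Qed.

Definition sum_loop r u e := Loop u 0 (Assign r (Bin Add (Reg r) e)).

Lemma sum_ord_recr n (f : 'I_n -> nat) (v : 'I_n) :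
  \sum_(u < n | u < v.+1) f u = \sum_(u < n | u < v) f u + f v.
Proof.
rewrite (bigD1 v) //= addnC; congr (_ + _); apply: eq_bigl => u.
by rewrite ltnS [RHS]ltn_neqAle andbC.
Qed.

(** Partial sums are bounded by the total, so only the total has to fit in a word. The assignment
    costs [cost e + 3], the loop 8 more per round. *)
Lemma runs_sum n w r u e s B (f : 'I_n -> nat) :
  r != u -> 0 != u -> 0 != r -> reg s 0 = n -> n < 2 ^ w -> 1 < 2 ^ w ->
  reg s r + \sum_v f v < 2 ^ w ->
  (forall (v : 'I_n) s', frame (sum_loop r u e) s s' -> reg s' u = v ->
     fits w s' e /\ ev s' e = f v) ->
  (cost e + 11) * n + 6 <= B ->
  runs w (sum_loop r u e) s B (fun s' => reg s' r = reg s r + \sum_v f v).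
Proof.
move=> ru u0 r0 s0 nw w1 fw He HB.
pose I i s' := reg s' r = reg s r + \sum_(v < n | v < i) f v.
apply: (runs_weaken (Q := I n) _ (leqnn _)); last first.
  by move=> s' _ /= Is'; rewrite Is'; congr (_ + _); apply: eq_bigl => v; rewrite ltn_ord.
apply: (runs_loop (I := I) (tau := fun _ => cost e + 3) _ _ s0 nw w1).
- by rewrite inE eq_sym.
- by rewrite !inE negb_or u0.
- by rewrite /I /= (negPf ru) big_pred0 // addn0.
- move=> v s' fr s'u Is'; have [fe ee] := He v s' fr s'u.
  have le_sum : reg s r + \sum_(v0 < n | v0 < v.+1) f v0 <= reg s r + \sum_v0 f v0.
    rewrite leq_add2l [leqRHS](bigID (fun v0 : 'I_n => v0 < v.+1)) /= leq_addr //.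
  rewrite sum_ord_recr in le_sum.
  apply: runs_assign => /=.
  + by split=> //; rewrite ee Is'; lia.
  + by lia.
  by rewrite /I /= (negPf ru) eqxx ee sum_ord_recr Is'; lia.
by rewrite sum_nat_const card_ord; lia.
Qed.

(** * The program *)

(* Registers: 3 the current size a; 4 and 5 delimit the rows of level a, and
   5 and 6 those of level a + 1 found so far; 7 a row of level a; 8 the vertex
   to be added to it; 9 a vertex; 12 a row of level a + 1; 10, 11, 13 and 14
   are counters.
   Banks: 2 holds the rows, 3 the outdegrees, 4 the cut of each row.  Cell u
   of a row is 0 if u is absent, and its position plus 1 otherwise. *)

Definition address i j := Bin Add (Bin Mul (Reg i) (Reg 0)) (Reg j).
Definition arc i j := Read 0 (address i j).
Definition row i j := Read 2 (address i j).
(** Tests are numbers 0 and 1: this is negation, and [Mul] serves as conjunction. *)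
Definition is_zero e := Bin Eq e (Const 0).

Definition degrees := Loop 8 0
  (Seq (Assign 10 (Const 0))
  (Seq (sum_loop 10 9 (arc 8 9))
       (Write 3 (Reg 8) (Reg 10)))).

Definition near_test :=
  Bin Mul (is_zero (row 7 8))
    (Bin Lt (Read 3 (Reg 8)) (Bin Add (Bin Add (Reg 3) (Reg 1)) (Const 1))).

(* Row i and vertex v give a set already present iff n cells agree. *)
Definition count_duplicates :=
  Seq (Assign 14 (Const 0))
  (Seq (Assign 12 (Reg 5))
  (For 12 6
    (Seq (Assign 13 (Const 0))
    (Seq (sum_loop 13 9 (Bin Eq (is_zero (row 12 9))
            (Bin Mul (is_zero (row 7 9)) (is_zero (Bin Eq (Reg 9) (Reg 8))))))
         (Assign 14 (Bin Add (Reg 14) (Bin Eq (Reg 13) (Reg 0)))))))).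

Definition append_row :=
  Seq (Loop 9 0 (Write 2 (address 6 9)
        (Bin Add (row 7 9) (Bin Mul (Bin Eq (Reg 9) (Reg 8)) (Bin Add (Reg 3) (Const 1))))))
  (Seq (Write 4 (Reg 6) (Bin Sub (Reg 10) (Reg 11)))
       (Assign 6 (Bin Add (Reg 6) (Const 1)))).

(** The two sides of [cut_add]: register 10 receives the old cut plus the arcs gained, register 11
    the arcs lost. *)
Definition new_cut :=
  Seq (Assign 10 (Read 4 (Reg 7)))
  (Seq (Assign 11 (Const 0))
  (Seq (sum_loop 10 9 (Bin Mul (is_zero (row 7 9)) (arc 8 9)))
       (sum_loop 11 9 (Bin Mul (Bin Lt (Const 0) (row 7 9)) (arc 9 8))))).

Definition try_vertex :=
  Ite near_test
    (Seq new_cut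
      (Ite (Bin Lt (Reg 10) (Bin Add (Reg 11) (Bin Add (Reg 1) (Const 1))))
        (Seq count_duplicates (Ite (is_zero (Reg 14)) append_row Skip))
        Skip))
    Skip.

(** Levels lie consecutively in bank 2, so passing to the next one only moves the delimiters.
    Register 5 stays fixed during the scan while register 6 grows. *)
Definition search := Loop 3 0
  (Seq (Assign 7 (Reg 4))
  (Seq (For 7 5 (Loop 8 0 try_vertex))
  (Seq (Assign 4 (Reg 5))
       (Assign 5 (Reg 6))))).

(** A full row holds the inverse of the ordering; sending each vertex to its position inverts it
    again. *)
Definition print_row := Loop 9 0 (Write 1 (Bin Sub (row 4 9) (Const 1)) (Reg 9)).

Definition main :=
  Ite (Reg 2) (Assign 0 (Const 0))
  (Seq degrees
  (Seq (Assign 5 (Const 1))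
  (Seq (Assign 6 (Const 1))
  (Seq search
  (Ite (Bin Lt (Reg 4) (Reg 5))
    (Seq print_row (Assign 0 (Const 1)))
    (Assign 0 (Const 0))))))).

(** * Correctness and running time *)

Section Correctness.
Variables (n : nat) (T : rel 'I_n) (k w S : nat).
Hypotheses (irrT : irreflexive T) (semiT : semicomplete T).
Hypothesis SE : S = 2 ^ (6 * k).+1.
(** Row indices never exceed [n.+1 * S + 1], so the product exceeds every address; the other terms
    leave room for sums with [k] and small constants. *)
Hypothesis word : (n.+1 * S + 2) * n.+1 + 2 * k + 10 < 2 ^ w.
Implicit Types (p q : seq 'I_n) (L R : seq (seq 'I_n)) (s : state).

Let S_gt0 : 0 < S. Proof. by rewrite SE expn_gt0. Qed.
Let n_word : n.+1 < 2 ^ w. Proof. by move: word; nia. Qed.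
Let one_word : 1 < 2 ^ w. Proof. by move: word; lia. Qed.

Definition enc p (u : 'I_n) := if u \in p then (index u p).+1 else 0.

Definition row_is s i p :=
  (forall u : 'I_n, mem s 2 (i * n + u) = enc p u) /\ mem s 4 i = cut T (vset p).

Definition queue s base L :=
  forall j, j < size L -> row_is s (base + j) (nth [::] L j).

Definition graph_loaded s :=
  [/\ reg s 0 = n, reg s 1 = k & forall i j : 'I_n, mem s 0 (i * n + j) = T i j].

Definition degrees_loaded s := forall v : 'I_n, mem s 3 v = outdeg T v.

Ltac unframe := repeat match goal with
  | fr : frame _ _ ?s' |- context [reg ?s' ?r] => rewrite (fr.1 r isT)
  | fr : frame _ _ ?s' |- context [mem ?s' ?b ?i] => rewrite (fr.2 b i isT)
  end.

Lemma sum_bool (f : 'I_n -> bool) : \sum_u f u = #|[set u | f u]|.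
Proof.
by rewrite -sum1_card [RHS]big_mkcond; apply: eq_bigr => u _; rewrite inE; case: (f u).
Qed.

Lemma sum_bool_le (f : 'I_n -> bool) : \sum_u f u <= n.
Proof. by rewrite sum_bool -[leqRHS]card_ord max_card. Qed.

Lemma enc_eq0 p u : (enc p u == 0) = (u \notin p).
Proof. by rewrite /enc; case: (u \in p). Qed.

Lemma ord_index (v : 'I_n) : v <= n.+1 * S + 1.
Proof. by have := ltn_ord v; nia. Qed.

Lemma fits_address s i j i' (u : 'I_n) : reg s 0 = n -> reg s i = i' ->
  i' <= n.+1 * S + 1 -> reg s j = u -> fits w s (address i j).
Proof.
move=> s0 si i'_le sj; have := ltn_ord u.
by rewrite /= s0 si sj; do !split; move: word; nia.
Qed.

Lemma row_is_frame s s' i p : row_is s i p ->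
  (forall i, mem s' 2 i = mem s 2 i) -> (forall i, mem s' 4 i = mem s 4 i) ->
  row_is s' i p.
Proof. by move=> [r c] e2 e4; split=> [u|]; rewrite ?e2 ?e4. Qed.

Lemma runs_degrees s : graph_loaded s ->
  runs w degrees s (100 * n.+1 * n.+1) degrees_loaded.
Proof.
move=> [s0 s1 sT].
pose I i s' := forall v : 'I_n, v < i -> mem s' 3 v = outdeg T v.
apply: (runs_weaken (Q := I n) _ (leqnn _)); last by move=> s' _ H v; apply: H.
apply: (runs_loop (I := I) (tau := fun=> 20 * n + 20) _ _ s0) => //.
- by rewrite ltnW.
- move=> v s1' fr1 s1v Is1.
  apply: (runs_seq (B1 := 2) (R := fun s' => reg s' 10 = 0)).
  + by apply: runs_assign => //=; lia.
  + by lia.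
  move=> s2 fr2 s2_10.
  apply: (runs_seq (B1 := 17 * n + 6)
    (R := fun s' => reg s' 10 = reg s2 10 + \sum_u T v u)).
  + apply: runs_sum => //; try (simpl; lia).
    * by unframe.
    * by rewrite s2_10 add0n (leq_ltn_trans (sum_bool_le _)) // ltnW.
    * move=> u s3 fr3 s3u.
      have s30 : reg s3 0 = n by unframe.
      have s38 : reg s3 8 = v by unframe.
      split; first exact: fits_address s30 s38 (ord_index v) s3u.
      by rewrite /= s30 s38 s3u; unframe.
  + by lia.
  move=> s3 fr3 s3_10; apply: runs_write => //=; first by lia.
  move=> u; rewrite ltnS leq_eqVlt /=.
  have -> : reg s3 8 = v by unframe.
  case: eqVneq => [/val_inj-> _|_ /= uv]; last by unframe; apply: Is1.
  by rewrite s3_10 s2_10 add0n sum_bool.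
by rewrite sum_nat_const card_ord; nia.
Qed.

Lemma runs_new_cut s i p (v : 'I_n) : graph_loaded s -> reg s 7 = i ->
  i <= n.+1 * S + 1 -> row_is s i p -> reg s 8 = v -> cut T (vset p) <= k ->
  v \notin p ->
  runs w new_cut s (60 * n + 30)
    (fun s' => reg s' 10 = cut T (vset p) + out_in T v (~: vset p) /\
               reg s' 11 = in_from T v (vset p)).
Proof.
move=> [s0 s1 sT] s7 i_le [rp cp] s8 cutp vp.
apply: (runs_seq (B1 := 3) (R := fun s' => reg s' 10 = cut T (vset p))).
- by apply: runs_assign => //=; rewrite s7.
- by lia.
move=> s2 fr2 s2_10.
apply: (runs_seq (B1 := 2) (R := fun s' => reg s' 11 = 0)).
- by apply: runs_assign => //=; lia.
- by lia.
move=> s3 fr3 s3_11.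
apply: (runs_seq (B1 := 30 * n + 6)
  (R := fun s' => reg s' 10 = reg s3 10 + \sum_u ((u \notin p) && T v u))).
- apply: runs_sum => //; try (simpl; lia).
  + by unframe.
  + have -> : reg s3 10 = cut T (vset p) by unframe.
    by apply: leq_ltn_trans (leq_add cutp (sum_bool_le _)) _; nia.
  move=> u s4 fr4 s4u.
  have s40 : reg s4 0 = n by unframe.
  have s47 : reg s4 7 = i by unframe.
  have s48 : reg s4 8 = v by unframe.
  have s4r : mem s4 2 (i * n + u) = enc p u by unframe.
  have s4T : mem s4 0 (v * n + u) = T v u by unframe.
  have f1 := fits_address s40 s47 i_le s4u.
  have f2 := fits_address s40 s48 (ord_index v) s4u.
  split; last by rewrite /= s40 s47 s48 s4u s4r s4T enc_eq0 mulnb.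
  move: f1 f2 => /= f1 f2.
  rewrite s40 s47 s48 s4u s4r s4T enc_eq0 in f1 f2 *; do !split=> //; rewrite ?mulnb; lia.
- by lia.
move=> s4 fr4 s4_10.
apply: (runs_weaken (Q := fun s' => reg s' 11 =
  reg s4 11 + \sum_u ((u \in p) && T u v)) _ (leqnn _)); last first.
  move=> s5 fr5 ->.
  have -> : reg s5 10 = reg s4 10 by unframe.
  have -> : reg s4 11 = 0 by unframe.
  have s3_10 : reg s3 10 = cut T (vset p) by unframe.
  rewrite s4_10 s3_10 !sum_bool; split; last by apply: eq_card => u; rewrite !inE.
  by congr (_ + _); apply: eq_card => u; rewrite !inE.
apply: runs_sum => //; try (simpl; lia).
- by unframe.
- have -> : reg s4 11 = 0 by unframe.
  by apply: leq_ltn_trans (sum_bool_le _) _; nia.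
move=> u s5 fr5 s5u.
have s50 : reg s5 0 = n by unframe.
have s57 : reg s5 7 = i by unframe.
have s58 : reg s5 8 = v by unframe.
have s5r : mem s5 2 (i * n + u) = enc p u by unframe.
have s5T : mem s5 0 (u * n + v) = T u v by unframe.
have f1 := fits_address s50 s57 i_le s5u.
have f2 := fits_address s50 s5u (ord_index u) s58.
have enc_gt0 : 0 < enc p u = (u \in p) by rewrite lt0n enc_eq0 negbK.
split; last by rewrite /= s50 s57 s58 s5u s5r s5T enc_gt0 mulnb.
move: f1 f2 => /= f1 f2.
rewrite s50 s57 s58 s5u s5r s5T enc_gt0 in f1 f2 *; do !split=> //; rewrite ?mulnb; lia.
Qed.

Lemma runs_count_duplicates s i p (v : 'I_n) hi R : reg s 0 = n -> reg s 7 = i ->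
  i <= n.+1 * S + 1 -> row_is s i p -> reg s 8 = v ->
  reg s 5 = hi -> reg s 6 = hi + size R -> hi + size R <= n.+1 * S + 1 ->
  queue s hi R ->
  runs w count_duplicates s (size R * (40 * n + 40) + 20)
    (fun s' => reg s' 14 = count (fun q => vset q == vset (rcons p v)) R).
Proof.
move=> s0 s7 i_le [rp _] s8 s5 s6 hi_le queueR.
apply: (runs_seq (B1 := 2) (R := fun s' => reg s' 14 = 0)).
- by apply: runs_assign => //=; lia.
- by lia.
move=> s2 fr2 s2_14.
apply: (runs_seq (B1 := 2) (R := fun s' => reg s' 12 = hi)).
- by apply: runs_assign => //=; unframe.
- by lia.
move=> s3 fr3 s3_12.
pose I j s' := reg s' 14 = count (fun q => vset q == vset (rcons p v)) (take (j - hi) R).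
apply: (runs_weaken (Q := fun s' => reg s' 12 = hi + size R /\ I (hi + size R) s')
  _ (leqnn _)); last first.
  by move=> s' _ [_]; rewrite /I addKn take_size.
apply: (runs_for (I := I) (tau := fun=> 40 * n + 30) (lo := hi)) => //.
- by unframe.
- by lia.
- by rewrite leq_addr.
- by rewrite /I subnn take0; unframe.
- move=> j s4 /andP[hi_j j_lt] fr4 s4_12 Is4.
  apply: (runs_seq (B1 := 2) (R := fun s' => reg s' 13 = 0)).
  + by apply: runs_assign => //=; lia.
  + by lia.
  move=> s5' fr5 s5_13.
  set q := nth [::] R (j - hi).
  have jR : j - hi < size R by lia.
  apply: (runs_seq (B1 := 34 * n + 6) (R := fun s' => reg s' 13 = reg s5' 13 +
      \sum_u ((u \notin q) == (u \notin rcons p v) : bool))).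
  + apply: runs_sum => //; try (simpl; lia).
    * by unframe.
    * by rewrite s5_13 (leq_ltn_trans (sum_bool_le _)) // ltnW.
    * move=> u s6' fr6 s6u.
      have s60 : reg s6' 0 = n by unframe.
      have s67 : reg s6' 7 = i by unframe.
      have s68 : reg s6' 8 = v by unframe.
      have s612 : reg s6' 12 = j by unframe.
      have s6p : mem s6' 2 (i * n + u) = enc p u by unframe.
      have s6q : mem s6' 2 (j * n + u) = enc q u.
        by unframe; have [+ _] := queueR _ jR; rewrite subnKC // => ->.
      have f1 := fits_address s60 s67 i_le s6u.
      have j_le : j <= n.+1 * S + 1 by lia.
      have f2 := fits_address s60 s612 j_le s6u.
      have eqE : (u == v :> nat) = (u == v) by [].
      split.
        move: f1 f2 => /= f1 f2.
        rewrite s60 s67 s68 s612 s6u s6p s6q !enc_eq0 in f1 f2 *.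
        do !split=> //; lia.
      rewrite /= s60 s67 s68 s612 s6u s6p s6q !enc_eq0 eqE mem_rcons inE negb_or.
      by case: (u == v); case: (u \in p); case: (u \in q).
  + by lia.
  move=> s6' fr6; rewrite s5_13 add0n sum_bool => s6_13.
  have card_eq : (#|[set u | (u \notin q) == (u \notin rcons p v)]| == n) =
                 (vset q == vset (rcons p v)).
    rewrite -[X in _ == X]card_ord -cardsT; apply/eqP/eqP => [eq_card|eq_set].
      apply/setP => u.
      have /setP/(_ u) : [set u | (u \notin q) == (u \notin rcons p v)] = setT.
        by apply/eqP; rewrite eqEcard subsetT eq_card leqnn.
      by rewrite !inE => /eqP/negb_inj.
    by apply: eq_card => u; have /setP/(_ u) := eq_set; rewrite !inE => ->; rewrite eqxx.
  have s6_0 : reg s6' 0 = n by unframe.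
  have s6_14 : reg s6' 14 = count (fun q => vset q == vset (rcons p v)) (take (j - hi) R).
    by unframe.
  have count_le := count_size (fun q => vset q == vset (rcons p v)) (take (j - hi) R).
  rewrite size_take jR in count_le.
  apply: runs_assign => /=.
  + by rewrite s6_0 s6_13 s6_14 card_eq; do !split=> //; move: word; case: (_ == _); nia.
  + by lia.
  rewrite /I /= s6_0 s6_13 s6_14 card_eq subSn // (take_nth [::]) //.
  by rewrite -[rcons (take _ _) _]cats1 count_cat /= addn0.
by rewrite sum_nat_const_nat; nia.
Qed.

(** The identity behind [append_row]: the cell of [v] was 0, so adding [(size p).+1] there records
    its position. *)
Lemma enc_rcons p (u v : 'I_n) : v \notin p ->
  enc (rcons p v) u = enc p u + (u == v) * (size p).+1.
Proof.
move=> vp; rewrite /enc mem_rcons inE -cats1 index_cat.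
have [->|_] := eqVneq u v; first by rewrite (negPf vp) /= eqxx addn0 mul1n.
by rewrite addn0 /=; case: (u \in p).
Qed.

(** Writing row [j] therefore leaves all earlier rows intact. *)
Lemma address_lt i j (u : 'I_n) : i < j -> i * n + u < j * n.
Proof. by move=> ij; have := ltn_ord u; nia. Qed.

Lemma runs_append_row s i p (v : 'I_n) hi R : reg s 0 = n -> reg s 3 = size p ->
  reg s 7 = i -> i < hi -> row_is s i p -> reg s 8 = v -> v \notin p -> size p < n ->
  reg s 6 = hi + size R -> hi + size R <= n.+1 * S + 1 ->
  reg s 10 - reg s 11 = cut T (v |: vset p) -> reg s 10 < 2 ^ w -> queue s hi R ->
  runs w append_row s (40 * n + 30) (fun s' =>
    [/\ reg s' 6 = hi + size (rcons R (rcons p v)), queue s' hi (rcons R (rcons p v)) &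
        forall j q, j < hi -> row_is s j q -> row_is s' j q]).
Proof.
move=> s0 s3 s7 i_hi [rp cp] s8 vp p_lt s6 hi_le cutE s10 queueR.
set m := hi + size R in s6 hi_le *.
(* The second clause keeps the source row [i] readable while row [m] is being filled. *)
pose I u s' := (forall x : 'I_n, x < u -> mem s' 2 (m * n + x) = enc (rcons p v) x) /\
               (forall a, a < m * n -> mem s' 2 a = mem s 2 a).
have i_m : i < m by rewrite /m; lia.
apply: (runs_seq (B1 := 30 * n + 6) (R := I n)).
- apply: (runs_loop (I := I) (tau := fun=> 22) _ _ s0) => //.
  + by rewrite ltnW.
  + move=> u s' fr su [Is1 Is2].
    have s'0 : reg s' 0 = n by unframe.
    have s'6 : reg s' 6 = m by unframe.
    have s'7 : reg s' 7 = i by unframe.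
    have s'8 : reg s' 8 = v by unframe.
    have s'3 : reg s' 3 = size p by unframe.
    have s'r : mem s' 2 (i * n + u) = enc p u by rewrite Is2 ?rp // address_lt.
    have i_le : i <= n.+1 * S + 1 by lia.
    have f1 := fits_address s'0 s'7 i_le su.
    have f2 := fits_address s'0 s'6 hi_le su.
    have eqE : (u == v :> nat) = (u == v) by [].
    have enc_le : enc p u <= n.
      by rewrite /enc; case: ifP => // up; apply: leq_trans (ltnW p_lt); rewrite index_mem.
    move: f1 f2 => /= f1 f2.
    apply: runs_write => //=.
    * rewrite s'0 s'3 s'7 s'8 su s'r eqE in f1 f2 *.
      by do !split=> //; move: word; case: (u == v); nia.
    split=> [x|a a_lt] /=.
      rewrite ltnS s'0 s'3 s'6 s'7 s'8 su s'r eqE addn1 -(enc_rcons u vp).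
      by rewrite eqn_add2l leq_eqVlt; case: eqVneq => [/val_inj->|_ /= /Is1].
    by rewrite s'0 s'6 su; case: eqP => [a_eq|_]; [lia|exact: Is2].
  by rewrite sum_nat_const card_ord; lia.
- by lia.
move=> s1 fr1 [Is1 Is2].
have s1_6 : reg s1 6 = m by unframe.
have s1_10 : reg s1 10 = reg s 10 by unframe.
have s1_11 : reg s1 11 = reg s 11 by unframe.
apply: (runs_seq (B1 := 5) (R := fun s' => forall a,
   mem s' 4 a = if a == m then cut T (v |: vset p) else mem s 4 a)).
- apply: runs_write => //=; first by do !split=> //; lia.
  move=> a; rewrite s1_6 s1_10 s1_11 cutE; case: ifP => // _; by unframe.
- by lia.
move=> s2 fr2 s2_4.
have s2_6 : reg s2 6 = m by unframe.
apply: runs_assign => //=; rewrite ?s2_6.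
- by do !split=> //; move: word; nia.
- by lia.
have old j q : j < m -> row_is s j q -> row_is (set_reg s2 6 (m + 1)) j q.
  move=> j_m [rq cq]; split=> [u|] /=; last by rewrite s2_4 ltn_eqF.
  by rewrite (fr2.2 2 _ isT) Is2 ?rq // address_lt.
split; first by rewrite size_rcons addn1 addnS.
- move=> j; rewrite size_rcons ltnS leq_eqVlt => /predU1P[->|j_R].
    rewrite nth_rcons ltnn eqxx -/m; split=> [u|] /=; last by rewrite s2_4 eqxx vset_rcons.
    by rewrite (fr2.2 2 _ isT) Is1.
  by rewrite nth_rcons j_R; apply: old; [rewrite ltn_add2l|exact: queueR].
by move=> j q j_hi; apply: old; rewrite /m; lia.
Qed.

(** Dominated by the comparison with up to [S] rows of [n] cells. *)
Definition vertex_cost := 100 * n.+1 * S.+1.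

(** The large cost is charged to near vertices only; any other vertex pays a constant for the
    test. *)
Lemma runs_try_vertex s i p (v : 'I_n) hi R : graph_loaded s -> degrees_loaded s ->
  reg s 3 = size p -> size p < n -> reg s 7 = i -> i < hi -> row_is s i p ->
  valid T k p -> reg s 8 = v -> reg s 5 = hi -> hi <= n * S + 1 ->
  reg s 6 = hi + size R -> queue s hi R -> distinct T k (size p).+1 R ->
  runs w try_vertex s (30 + (v \in near T k p) * vertex_cost) (fun s' =>
    let R' := extend1 T k p R v in
    [/\ reg s' 6 = hi + size R', queue s' hi R' &
        forall j q, j < hi -> row_is s j q -> row_is s' j q]).
Proof.
move=> load deg s3 p_lt s7 i_hi rowp valp s8 s5 hi_le s6 queueR distR.
have [s0 s1 sT] := load; have [rp cp] := rowp.
have R_le : size R <= S by rewrite SE; apply: size_distinct distR.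
have m_le : hi + size R <= n.+1 * S + 1 by lia.
have i_le : i <= n.+1 * S + 1 by lia.
have deg_le : outdeg T v <= n by rewrite -[leqRHS]card_ord max_card.
have f1 := fits_address s0 s7 i_le s8.
have testE : ev s near_test = (v \in near T k p).
  by rewrite /= s0 s1 s3 s7 s8 rp deg enc_eq0 mulnb inE addn1 ltnS.
apply: runs_ite.
- move: f1 => /= f1; rewrite s0 s1 s3 s7 s8 rp deg enc_eq0 in f1 *.
  by do !split=> //; rewrite ?mulnb; lia.
- by rewrite /=; lia.
- rewrite testE inE; case: (boolP (v \in p)) => //= vp.
  case: (boolP (outdeg T v <= size p + k)) => //= dv _; rewrite mul1n.
  have budget : 60 * n + 30 + 60 + S * (40 * n + 40) + 40 * n + 30 <= vertex_cost.
    by rewrite /vertex_cost; nia.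
  have R_cost : size R * (40 * n + 40) <= S * (40 * n + 40) by rewrite leq_mul2r R_le orbT.
  have vX : v \notin vset p by rewrite inE.
  have cutE := cut_add irrT vX.
  have out_le : out_in T v (~: vset p) <= n by rewrite -[leqRHS]card_ord max_card.
  have in_le : in_from T v (vset p) <= n by rewrite -[leqRHS]card_ord max_card.
  have cut_le := valid_cut valp.
  apply: (runs_seq (runs_new_cut load s7 i_le rowp s8 cut_le vp)); first by lia.
  move=> s2 fr2 [s2_10 s2_11].
  have s2_1 : reg s2 1 = k by unframe.
  have testcut : (reg s2 10 < reg s2 11 + (k + 1)) = (cut T (v |: vset p) <= k).
    by rewrite s2_10 s2_11 -cutE; lia.
  have row_s2 j q : row_is s j q -> row_is s2 j q.
    by move=> /row_is_frame; apply=> a; unframe.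
  apply: runs_ite.
  + by rewrite /= s2_10 s2_11 s2_1; do !split=> //; move: word; nia.
  + by rewrite /=; lia.
  + rewrite /= s2_1 testcut /extend1 /candidate vp dv /=.
    case: ifP => //= cutv _.
    apply: (runs_seq (B1 := size R * (40 * n + 40) + 20)).
    * apply: (@runs_count_duplicates s2 i p v hi R) => //; try by unframe.
        exact: row_s2.
      by move=> j jR; apply/row_s2/queueR.
    * by lia.
    move=> s3' fr3 s3_14.
    have row_s3 j q : row_is s j q -> row_is s3' j q.
      by move=> /row_s2 /row_is_frame; apply=> a; unframe.
    rewrite /= in s3_14.
    have dupE : (reg s3' 14 == 0) = (vset (rcons p v) \notin map (@vset _) R).
      rewrite s3_14 -leqn0 leqNgt -has_count; congr (~~ _).
      by apply/hasP/mapP => [[q qR /eqP <-]|[q qR ->]]; exists q.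
    rewrite /insert; apply: runs_ite.
    * by rewrite /= s3_14; do !split=> //; lia.
    * by rewrite /=; lia.
    * rewrite /= dupE; case: ifP => //= _ _.
      apply: (runs_weaken (@runs_append_row s3' i p v hi R _ _ _ _ _ _ _ _ _ _ _ _ _)) => //;
        try by unframe.
      -- by apply: row_s3.
      -- have -> : reg s3' 10 = reg s2 10 by unframe.
         have -> : reg s3' 11 = reg s2 11 by unframe.
         by rewrite s2_10 s2_11 -cutE addnK.
      -- have -> : reg s3' 10 = reg s2 10 by unframe.
         by rewrite s2_10; move: word; nia.
      -- by move=> j jR; apply/row_s3/queueR.
      -- by lia.
      -- by move=> s' _ [s'6 s'q s'row]; split=> // j q j_hi /row_s3; apply: s'row.
    rewrite /= dupE; case: ifP => //= _ _; apply: runs_skip; first by lia.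
    split; first by unframe.
      by move=> j jR; apply/row_s3/queueR.
    by move=> j q _; apply: row_s3.
  rewrite /= s2_1 testcut /extend1 /candidate vp dv /=.
  case: ifP => //= _ _; apply: runs_skip; first by lia.
  split; first by unframe.
    by move=> j jR; apply/row_s2/queueR.
  by move=> j q _; apply: row_s2.
rewrite testE => near0; apply: runs_skip; first by rewrite /=; lia.
have -> : extend1 T k p R v = R.
  rewrite /extend1 /candidate; move: near0; rewrite inE andbA.
  by case: (_ && _).
by split.
Qed.

Definition level_cost := S * (38 * n + (4 * k).+1 * vertex_cost + 20) + 30.

(** The offset [lo] depends on the sizes of all earlier levels; only the bound on the end is kept,
    one row for the empty segment and at most [S] for each later level. *)
Definition level_stored a s := exists lo,
  [/\ reg s 4 = lo, reg s 5 = lo + size (level T k a), reg s 6 = reg s 5,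
      lo + size (level T k a) <= a * S + 1 & queue s lo (level T k a)].

Lemma runs_extend s i p hi R : graph_loaded s -> degrees_loaded s ->
  reg s 3 = size p -> size p < n -> reg s 7 = i -> i < hi -> row_is s i p ->
  valid T k p -> reg s 5 = hi -> hi <= n * S + 1 ->
  reg s 6 = hi + size R -> queue s hi R -> distinct T k (size p).+1 R ->
  runs w (Loop 8 0 try_vertex) s (38 * n + (4 * k).+1 * vertex_cost + 6) (fun s' =>
    let R' := extend T k R p in
    [/\ reg s' 6 = hi + size R', queue s' hi R' &
        forall j q, j < hi -> row_is s j q -> row_is s' j q]).
Proof.
move=> load deg s3 p_lt s7 i_hi rowp valp s5 hi_le s6 queueR distR.
have [s0 s1 sT] := load.
pose Rv u := foldl (extend1 T k p) R (take u (enum 'I_n)).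
have distRv u : distinct T k (size p).+1 (Rv u) by apply: foldl_distinct.
pose I u s' := [/\ reg s' 6 = hi + size (Rv u), queue s' hi (Rv u) &
  forall j q, j < hi -> row_is s j q -> row_is s' j q].
apply: (runs_weaken (Q := I n) _ (leqnn _)); last first.
  by move=> s' _; rewrite /I /Rv -[X in take X]size_enum_ord take_size.
apply: (runs_loop (I := I)
  (tau := fun v => 30 + (v \in near T k p) * vertex_cost) _ _ s0) => //.
- by rewrite ltnW.
- by rewrite /I /Rv take0; split.
- move=> v s2 fr s2v [s2_6 queue2 row2].
  have load2 : graph_loaded s2 by split; [unframe|unframe|move=> x y; unframe].
  have deg2 : degrees_loaded s2 by move=> x; unframe.
  apply: (runs_weaken (@runs_try_vertex s2 i p v hi (Rv v) load2 deg2
    _ _ _ i_hi _ _ _ _ _ _ _ _)) => //; try by unframe.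
  + by apply: row2.
  move=> s' _ /= [s'6 queue' row'].
  have RvS : extend1 T k p (Rv v) v = Rv v.+1.
    rewrite /Rv (take_nth v) ?size_enum_ord // -cats1 foldl_cat /=.
    by rewrite nth_ord_enum.
  rewrite RvS in s'6 queue'; split=> // j q j_hi /(row2 _ _ j_hi); exact: row'.
(* Summing the indicator of [near] over all vertices counts the expensive rounds, and [card_near]
   bounds them by [(4 * k).+1]. *)
rewrite (eq_bigr (fun v => 38 + (v \in near T k p) * vertex_cost)) => [|v _]; last by lia.
rewrite big_split /= sum_nat_const card_ord -big_distrl /= sum_bool (mulnC n).
rewrite leq_add2r leq_add2l leq_mul2r.
have -> : [set v | v \in near T k p] = near T k p by apply/setP => v; rewrite inE.
by rewrite card_near ?orbT.
Qed.

Lemma runs_level s a : graph_loaded s -> degrees_loaded s -> reg s 3 = a -> a < n ->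
  level_stored a s ->
  runs w (Seq (Assign 7 (Reg 4))
         (Seq (For 7 5 (Loop 8 0 try_vertex))
         (Seq (Assign 4 (Reg 5)) (Assign 5 (Reg 6))))) s level_cost (level_stored a.+1).
Proof.
move=> load deg s3 a_lt [lo [s4 s5 s6 lo_le queueL]]; have [s0 s1 sT] := load.
set L := level T k a in s5 lo_le queueL *; set hi := lo + size L in s5 lo_le *.
have distL : distinct T k a L by apply: level_distinct.
have hi_le : hi <= n * S + 1.
  by apply: leq_trans lo_le _; rewrite leq_add2r leq_mul2r (ltnW a_lt) orbT.
have [allL _] := andP distL.
have L_le : size L <= S by rewrite SE; apply: size_distinct distL.
apply: (runs_seq (B1 := 2) (R := fun s' => reg s' 7 = lo)).
- by apply: runs_assign.
- by rewrite /level_cost; lia.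
move=> s2 fr2 s2_7.
pose Ri i := foldl (extend T k) [::] (take (i - lo) L).
have distR i : distinct T k a.+1 (Ri i).
  apply: foldl_extend_distinct => //; apply/allP => p /mem_take; exact: (allP allL).
pose I i s' := [/\ reg s' 6 = hi + size (Ri i), queue s' hi (Ri i) & queue s' lo L].
have hi_word : hi < 2 ^ w by move: word hi_le; nia.
apply: (runs_seq (B1 := level_cost - 10) (R := fun s' => reg s' 7 = hi /\ I hi s')).
- apply: (runs_for (I := I) (tau := fun=> 38 * n + (4 * k).+1 * vertex_cost + 6)
           (lo := lo)) => //.
  + by unframe.
  + by rewrite leq_addr.
  + rewrite /I /Ri subnn take0; split=> //; first by unframe; rewrite s6 s5 addn0.
    by move=> j jL; apply: row_is_frame (queueL _ jL) _ _ => x; unframe.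
  + move=> i s3' /andP[lo_i i_hi] fr3 s3_7 [s3_6 queueR queueL3].
    set p := nth [::] L (i - lo).
    have iL : i - lo < size L by rewrite /hi in i_hi; lia.
    have /andP[valp /eqP sp] : valid T k p && (size p == a).
      by apply: (allP allL); apply: mem_nth.
    have load3 : graph_loaded s3' by split; [unframe|unframe|move=> x y; unframe].
    have deg3 : degrees_loaded s3' by move=> x; unframe.
    apply: (runs_weaken (@runs_extend s3' i p hi (Ri i) load3 deg3 _ _ s3_7 i_hi _ valp
             _ hi_le s3_6 queueR _)) => //.
    * by rewrite sp; unframe.
    * by rewrite sp.
    * by have := queueL3 _ iL; rewrite subnKC.
    * by unframe.
    * by rewrite sp.
    move=> s' _ /= [s'6 queue' row'].
    have RiS : extend T k (Ri i) p = Ri i.+1.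
      by rewrite /Ri subSn // (take_nth [::]) // -[rcons (take _ _) _]cats1 foldl_cat.
    rewrite RiS in s'6 queue'; split=> // j jL.
    by apply: row' (queueL3 _ jL); rewrite /hi ltn_add2l.
  rewrite sum_nat_const_nat /hi addKn /level_cost.
  have : size L * (38 * n + (4 * k).+1 * vertex_cost + 6 + 8) <=
         S * (38 * n + (4 * k).+1 * vertex_cost + 20).
    by apply: leq_mul => //; lia.
  lia.
- by lia.
move=> s3' fr3 [s3_7 [s3_6 queueR _]].
have RhiE : Ri hi = level T k a.+1 by rewrite /Ri /hi addKn take_size.
rewrite RhiE in s3_6 queueR.
have L'_le : size (level T k a.+1) <= S.
  by rewrite SE; apply: size_distinct (level_distinct _ _ _).
apply: (runs_seq (B1 := 2) (R := fun s' => reg s' 4 = hi)).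
- by apply: runs_assign => //=; unframe.
- by rewrite /level_cost; lia.
move=> s4' fr4 s4_4; apply: runs_assign => //=.
  by rewrite /level_cost; lia.
exists hi; split=> //.
- by change (reg s4' 6 = hi + size (level T k a.+1)); unframe.
- by rewrite mulSn; lia.
by move=> j jL; apply: row_is_frame (queueR _ jL) _ _ => x /=; unframe.
Qed.

Lemma runs_search s : graph_loaded s -> degrees_loaded s -> level_stored 0 s ->
  runs w search s (n * (level_cost + 8) + 6) (level_stored n).
Proof.
move=> load deg lev0; have [s0 s1 sT] := load.
apply: (runs_loop (I := level_stored) (tau := fun=> level_cost) _ _ s0) => //.
- by rewrite ltnW.
- move=> a s2 fr s2_3 lev2.
  apply: (runs_weaken (@runs_level s2 a _ _ s2_3 (ltn_ord a) lev2)) => //.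
  + by split; [unframe|unframe|move=> x y; unframe].
  + by move=> x; unframe.
by rewrite sum_nat_const card_ord; lia.
Qed.

Lemma runs_print_row s lo p : reg s 0 = n -> reg s 4 = lo -> lo <= n.+1 * S + 1 ->
  row_is s lo p -> ordering p ->
  runs w print_row s (30 * n + 6) (fun s' => mkseq (mem s' 1) n = map val p).
Proof.
move=> s0 s4 lo_le [rp _] op.
have sp : size p = n by rewrite (perm_size op) size_enum_ord.
have memp x : x \in p by rewrite (perm_mem op) mem_enum.
pose I u s' := forall x : 'I_n, x < u -> mem s' 1 (index x p) = x.
apply: (runs_weaken (Q := I n) _ (leqnn _)); last first.
  move=> s' _ Is'; apply: (@eq_from_nth _ 0); rewrite size_mkseq ?size_map ?sp //.
  move=> j jn; rewrite nth_mkseq // (nth_map (Ordinal jn)) ?sp //.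
  have := Is' _ (ltn_ord (nth (Ordinal jn) p j)).
  by rewrite index_uniq ?sp // (perm_uniq op) enum_uniq.
apply: (runs_loop (I := I) (tau := fun=> 15) _ _ s0) => //.
- by rewrite ltnW.
- move=> u s2 fr s2u Is2.
  have s20 : reg s2 0 = n by unframe.
  have s24 : reg s2 4 = lo by unframe.
  have s2r : mem s2 2 (lo * n + u) = enc p u by unframe.
  have ind_lt : index u p < n by rewrite -[X in _ < X]sp index_mem.
  have encE : enc p u = (index u p).+1 by rewrite /enc memp.
  have f1 := fits_address s20 s24 lo_le s2u.
  apply: runs_write => //=.
  + move: f1 => /=; rewrite s20 s24 s2u s2r encE => f1; do !split=> //; lia.
  move=> x; rewrite ltnS s20 s24 s2u s2r encE subn1 /=.
  (* Distinct vertices have distinct positions, so this write spares the earlier ones. *)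
  case: eqVneq => [/(congr1 (nth u p))|ne_ind]; first by rewrite !nth_index // => ->.
  by rewrite leq_eqVlt => /predU1P[/val_inj eq_xu|/Is2//]; rewrite eq_xu eqxx in ne_ind.
by rewrite sum_nat_const card_ord; lia.
Qed.

Definition total_cost :=
  100 * n.+1 * n.+1 + n * (level_cost + 8) + 30 * n + 40.

Lemma adjacencyE (i j : 'I_n) : adjacency T (i * n + j) = T i j.
Proof.
have n_gt0 : 0 < n by apply: leq_trans (ltn_ord i).
rewrite /adjacency; congr nat_of_bool.
apply/existsP/idP => [[i' /existsP[j' /andP[/eqP eq_ij]]]|Tij].
  have [/val_inj <- /val_inj <- //] : i = i' :> nat /\ j = j' :> nat.
  have := congr1 (modn^~ n) eq_ij; have := congr1 (divn^~ n) eq_ij.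
  by rewrite !modnMDl !modn_small // !divnMDl // !divn_small // !addn0.
by exists i; apply/existsP; exists j; rewrite eqxx.
Qed.

Lemma runs_main : runs w main (input T k%:Z) total_cost (fun s =>
  (exists pi : seq 'I_n, [/\ ordering pi, width T pi <= k & outputs s pi])
  \/ (k < cutwidth T /\ rejects s)).
Proof.
set s0 := input T k; rewrite /total_cost.
apply: runs_ite => //=; first by lia.
move=> _.
have load0 : graph_loaded s0 by split=> // i j; apply: adjacencyE.
apply: (runs_seq (runs_degrees load0)); first by lia.
move=> s1 fr1 deg1.
apply: (runs_seq (B1 := 2) (R := fun s' => reg s' 5 = 1)).
- by apply: runs_assign => //=; lia.
- by lia.
move=> s2 fr2 s2_5.
apply: (runs_seq (B1 := 2) (R := fun s' => reg s' 6 = 1)).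
- by apply: runs_assign => //=; lia.
- by lia.
move=> s3 fr3 s3_6.
have load3 : graph_loaded s3.
  have [l0 l1 lT] := load0.
  by split; [unframe|unframe|move=> i j; unframe].
have deg3 : degrees_loaded s3 by move=> v; unframe.
(* Memory starts at zero, so row 0 already encodes the empty segment with its cut 0; registers 4, 5
   and 6 hold 0, 1 and 1. *)
have lev0 : level_stored 0 s3.
  exists 0; split; [by unframe|by unframe|by unframe; rewrite s3_6 s2_5|by []|].
  case=> // _; split=> [u|]; unframe; first by [].
  by apply/esym/eqP; rewrite -leqn0; apply/valid_cut/valid_nil.
apply: (runs_seq (runs_search load3 deg3 lev0)); first by lia.
move=> s4 fr4 [lo [s4_4 s4_5 s4_6 lo_le queueL]].
have distL : distinct T k n (level T k n) by apply: level_distinct.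
have s4_lt : (reg s4 4 < reg s4 5) = (0 < size (level T k n)).
  by rewrite s4_4 s4_5 -[X in X < _]addn0 ltn_add2l.
apply: runs_ite => //=.
- by do !split=> //; apply: leq_ltn_trans (leq_b1 _) one_word.
- by lia.
- rewrite s4_lt; case: posnP => //= L_gt0 _.
  set p := nth [::] (level T k n) 0.
  have pL : p \in level T k n by apply: mem_nth.
  have /andP[valp /eqP sp] := allP (proj1 (andP distL)) _ pL.
  have op : ordering p by apply: valid_ordering valp _; rewrite card_ord.
  have s4_0 : reg s4 0 = n by have [l0 _ _] := load3; unframe.
  have row_p : row_is s4 lo p by have := queueL _ L_gt0; rewrite addn0.
  apply: (runs_seq (runs_print_row s4_0 s4_4 _ row_p op)).
  + apply: leq_trans (leq_trans (leq_addr _ _) lo_le) _.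
    by rewrite leq_add2r leq_mul2r leqnSn orbT.
  + by lia.
  move=> s5 fr5 s5_out; apply: runs_assign => //=; first by lia.
  left; exists p; split=> //; exact: valid_width.
rewrite s4_lt => L0; apply: runs_assign => //=; [lia|lia|].
right; split=> //; apply: level_nil_cutwidth => //.
rewrite card_ord; apply: size0nil; lia.
Qed.

End Correctness.

(** * Estimates for the word length and the running time *)

Lemma word_bound n k w (S := 2 ^ (6 * k).+1) :
  8 * (k + trunc_log 2 n + 1) <= w ->
  (n.+1 * S + 2) * n.+1 + 2 * k + 10 < 2 ^ w.
Proof.
(* The claim is of order [K ^ 6 * N ^ 2]: [K ^ 6] from [S], one [N] for the levels and one for the
   row length. Against [(N * K) ^ 8], the six spare powers of [N >= 2] absorb the constants. *)
move=> w_ge; pose N := 2 ^ (trunc_log 2 n).+1; pose K := 2 ^ k.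
have n_lt : n < N by apply: trunc_log_ltn.
have kK : k < K by apply: ltn_expl.
have N_ge : 2 <= N by rewrite /N expnS leq_pmulr // expn_gt0.
have : (N * K) ^ 8 <= 2 ^ w.
  by rewrite /N /K -expnD -expnM leq_pexp2l //; lia.
apply: leq_trans.
have -> : S = 2 * K ^ 6 by rewrite /S expnS (mulnC 6) expnM.
have K6 : K <= K ^ 6 by rewrite -[leqLHS]expn1 leq_pexp2l //; lia.
have N8 : 64 * N ^ 2 <= N ^ 8.
  rewrite -[in leqRHS](_ : 6 + 2 = 8) // expnD leq_mul2r.
  by rewrite (leq_exp2r 2 N (isT : 0 < 6)) N_ge orbT.
have K8 : K ^ 6 <= K ^ 8 by rewrite leq_pexp2l //; lia.
have : (n.+1 * (2 * K ^ 6) + 2) * n.+1 <= 4 * (K ^ 6 * N ^ 2).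
  rewrite (_ : 4 * _ = (4 * (N * K ^ 6)) * N); last by rewrite -mulnn; lia.
  by apply: leq_mul => //; nia.
have N2 : 4 <= N ^ 2 by rewrite (leq_exp2r 2 N (isT : 0 < 2)).
have : 64 * N ^ 2 * K ^ 6 <= N ^ 8 * K ^ 8 by apply: leq_mul.
rewrite expnMn; move: K6 kK N2; move: (K ^ 6) (N ^ 2) (N ^ 8 * K ^ 8) => x y z.
nia.
Qed.

(** Comparing the extensions of one level pairwise costs the square of [2 ^ (6 * k).+1], that is
    [4 * 2 ^ (12 * k)]; the number [(4 * k).+1 <= 4 * 2 ^ k] of near vertices brings the exponent to
    [13 * k]. For [n = 0], [maxn 1 n] absorbs the additive constants. *)
Lemma total_cost_bound n k : total_cost n k (2 ^ (6 * k).+1) <=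
  2 ^ 13 * 2 ^ (13 * k) * maxn 1 n ^ 2.
Proof.
rewrite (mulnC 13) (expnM _ k); set m := maxn 1 n; set K := 2 ^ k.
have -> : 2 ^ (6 * k).+1 = 2 * K ^ 6 by rewrite expnS (mulnC 6) expnM.
have kK : k < K by apply: ltn_expl.
have nm : n <= m by apply: leq_maxr.
have m1 : 0 < m by apply: leq_maxl.
have K6 : 0 < K ^ 6 by rewrite expn_gt0 expn_gt0.
rewrite (_ : K ^ 13 = K ^ 6 * (K ^ 6 * K)); last by rewrite -expnSr -expnD.
rewrite /total_cost /level_cost /vertex_cost -mulnn; move: K6; move: (K ^ 6) => x x_gt0.
have vertex : 100 * n.+1 * (2 * x).+1 <= 600 * (m * x).
  rewrite (_ : 600 * (m * x) = 100 * (2 * m) * (3 * x)); last by lia.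
  by apply: leq_mul; lia.
move: (100 * n.+1 * (2 * x).+1) vertex => vc vertex.
have near : (4 * k).+1 * vc <= 2400 * (m * (x * K)).
  rewrite (_ : 2400 * _ = 4 * K * (600 * (m * x))); last by lia.
  by apply: leq_mul => //; lia.
have xK : 1 <= x * K by rewrite muln_gt0 x_gt0 (leq_ltn_trans _ kK).
have mxK : m <= m * (x * K) by rewrite leq_pmulr.
have level : 2 * x * (38 * n + (4 * k).+1 * vc + 20) + 38 <= 5000 * (m * (x * (x * K))).
  apply: (@leq_trans (2 * x * (2458 * (m * (x * K))) + 38 * (m * (x * (x * K))))).
    apply: leq_add; first by rewrite leq_mul2l; apply/orP; right; lia.
    by rewrite leq_pmulr // !muln_gt0 m1 x_gt0 (leq_ltn_trans _ kK).
  lia.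
have n_level : n * (2 * x * (38 * n + (4 * k).+1 * vc + 20) + 30 + 8) <=
               5000 * (x * (x * K)) * (m * m).
  rewrite (_ : 5000 * _ * _ = m * (5000 * (m * (x * (x * K))))); last by lia.
  by apply: leq_mul => //; lia.
have rest : 100 * n.+1 * n.+1 + 30 * n + 40 <= 500 * (m * m) by nia.
have xxK : m * m <= x * (x * K) * (m * m).
  by rewrite leq_pmull // !muln_gt0 x_gt0 (leq_ltn_trans _ kK).
have : 5500 * (x * (x * K) * (m * m)) <= 2 ^ 13 * (x * (x * K)) * (m * m).
  by rewrite -(mulnA (2 ^ 13)) leq_mul2r; apply/orP; right.
lia.
Qed.

Theorem theorem20 :
  exists (P : cmd) (a b c : nat),
  forall (n : nat) (T : rel 'I_n) (k : int) (w : nat),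
    irreflexive T -> semicomplete T ->
    c * (absz k + trunc_log 2 n + 1) <= w ->
    exists (s : state) (t : nat),
      [/\ exec w P (input T k) s t,
          t <= a * 2 ^ (b * absz k) * maxn 1 n ^ 2
        & (exists pi : seq 'I_n,
             [/\ ordering pi, ((width T pi)%:Z <= k)%R & outputs s pi])
          \/ ((k < (cutwidth T)%:Z)%R /\ rejects s)].
Proof.
exists main, (2 ^ 13), 13, 8 => n T k w irrT semiT w_ge.
case: k w_ge => [k|k] w_ge.
  have [s [t [ex tB Q]]] := runs_main irrT semiT erefl (word_bound w_ge).
  exists s, t; split=> //; exact: leq_trans tB (total_cost_bound n k).
(* A negative bound is rejected at once, rightly since a cutwidth is a natural number: 2 units for
   the test and 2 for the assignment. *)
exists (set_reg (input T (Negz k)) 0 0), 4; split.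
- apply: (@ExecIteTrue _ (Reg 2) _ _ _ _ 2) => //.
  by rewrite -[X in set_reg _ _ X](mod0n (2 ^ w)); apply: (@ExecAssign _ 0 (Const 0)).
- apply: (@leq_trans (2 ^ 13)) => //.
  by rewrite -mulnA leq_pmulr // muln_gt0 !expn_gt0 /= leq_max.
by right.
Qed.
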